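(* Let $R>0$, $m\in\mathbb{Z}$, and $N_0>0$. Let $(A,\lambda)$ be any nontrivial solution pair of the boundary value problem $$\frac{d^2A}{dr^2}+\frac1r\frac{dA}{dr}-\frac{m^2}{r^2}A-\lambda A+\frac{A^3}{(1+A^2)^2}=0,\quad r\in(0,R),\qquad A(0)=0=A(R),$$ with prescribed photon number $$N(A)=2\pi\int_0^R rA^2\,dr=N_0.$$ If $|m|\ge \dfrac{N_0}{2\pi}$, then $\lambda<0$.
   Context: A solution pair $(A,\lambda)$ consists of a real number $\lambda$ (the nonlinear frequency shift) and a real-valued function $A$, continuous on $[0,R]$ and twice differentiable on $(0,R)$, satisfying the differential equation on $(0,R)$ and the boundary conditions. It is nontrivial if $A\not\equiv0$. The integer $m$ is the topological charge. *)

(* Defs.v *)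
From Stdlib Require Import Reals ZArith.
From Coquelicot Require Import Coquelicot.
Open Scope R_scope.

(** Only the values of [A] on [[0, Rad]] matter: continuity is relative to the
    closed interval (one-sided at the endpoints), and derivatives are taken at
    interior points only. *)
Record solution_pair (Rad : R) (m : Z) (A : R -> R) (lambda : R) : Prop := {
  sol_continuous : continuous_on (fun r => 0 <= r <= Rad) A;
  sol_derivable : forall r, 0 < r < Rad -> ex_derive A r;
  sol_derivable2 : forall r, 0 < r < Rad -> ex_derive (Derive A) r;
  sol_equation : forall r, 0 < r < Rad ->
    Derive (Derive A) r + 1 / r * Derive A r - (IZR m) ^ 2 / r ^ 2 * A r
      - lambda * A r + (A r) ^ 3 / (1 + (A r) ^ 2) ^ 2 = 0;
  sol_boundary_0 : A 0 = 0;
  sol_boundary_R : A Rad = 0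
}.

Definition nontrivial (Rad : R) (A : R -> R) : Prop :=
  exists r, 0 <= r <= Rad /\ A r <> 0.

(** [RInt] is total; the integrand is Riemann integrable on [[0, Rad]] whenever
    [A] is continuous there. *)
Definition photon_number (Rad : R) (A : R -> R) : R :=
  2 * PI * RInt (fun r => r * (A r) ^ 2) 0 Rad.

(* Main.v *)
Require Import Defs.
From Stdlib Require Import Reals ZArith Lra.
From Coquelicot Require Import Coquelicot.
Open Scope R_scope.

(** Put [k = |m|], [M = max A^2], and let [n r] be the integral of [s * A s ^ 2]
    over [[0, r]], so that [n Rad = N0 / (2 * PI)].  Multiplying the equation by
    [r * A] gives
      [(r A A')' = r A'^2 + m^2 A^2 / r + lambda r A^2 - r A^4 / (1 + A^2)^2].
    By the arithmetic-geometric inequality [r A'^2 + m^2 A^2 / r] is at least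
    both [2 k A A'] and [- 2 k A A'], while the last term is at most [M r A^2].
    So if [lambda >= 0], both functions
      [r A A' - k A^2 + M n]   and   [r A A' + k A^2 + M n]
    are nondecreasing on [(0, Rad)] ([virial_nondecreasing]).

    Let [p] be a point where [A^2 = M].  Comparing the first function at [a < p]
    and [p], the second at [p] and [b > p], and adding, yields
      [2 k M <= b A A'(b) - a A A'(a) + k (A(a)^2 + A(b)^2) + M (n b - n a)].
    Since [A^2] is nonnegative and vanishes at both ends, there are [a] in
    [(0, p)] and [b] in [(p, Rad)] with [A A'(a) >= 0 >= A A'(b)] and with [A^2]
    below [M / 2] at both ([small_value_rising], [small_value_falling]).  As
    [M (n b - n a) <= M N0 / (2 PI) <= k M], this gives
    [k M <= k (A(a)^2 + A(b)^2) < k M], a contradiction. *)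

(** * Continuity and monotonicity *)

Definition clamp (a b x : R) : R := Rmax a (Rmin x b).

Lemma clamp_in (a b x : R) : a <= b -> a <= clamp a b x <= b.
Proof.
  intros H; unfold clamp, Rmax, Rmin.
  repeat destruct Rle_dec; lra.
Qed.

Lemma clamp_id (a b x : R) : a <= x <= b -> clamp a b x = x.
Proof.
  intros H; unfold clamp, Rmax, Rmin.
  repeat destruct Rle_dec; lra.
Qed.

Lemma clamp_contracting (a b x y : R) :
  a <= b -> Rabs (clamp a b y - clamp a b x) <= Rabs (y - x).
Proof.
  intros H; unfold clamp, Rmax, Rmin, Rabs.
  repeat destruct Rle_dec; repeat destruct Rcase_abs; lra.
Qed.

(** Extending by the endpoint values turns one-sided continuity into two-sided
    continuity, the form in which the extreme value theorem, the mean value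
    theorem and the differentiation of integrals are available. *)
Lemma continuous_clamp (f : R -> R) (a b : R) :
  a <= b -> continuous_on (fun x => a <= x <= b) f ->
  forall x, continuous (fun y => f (clamp a b y)) x.
Proof.
  intros Hab Hf x P HP.
  destruct (Hf (clamp a b x) (clamp_in a b x Hab) P HP) as [eps Heps].
  exists eps; intros y Hy.
  apply Heps.
  - apply Rle_lt_trans with (Rabs (y - x)); [|exact Hy].
    now apply clamp_contracting.
  - now apply clamp_in.
Qed.

Lemma is_derive_clamp (f : R -> R) (a b x l : R) :
  a < x < b -> is_derive f x l -> is_derive (fun y => f (clamp a b y)) x l.
Proof.
  intros Hx; apply is_derive_ext_loc.
  apply (locally_interval _ x a b); simpl; try tauto.
  intros y Hay Hyb.
  now rewrite clamp_id by (split; apply Rlt_le; assumption).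
Qed.

Lemma is_derive_continuity_pt (f : R -> R) (x l : R) :
  is_derive f x l -> continuity_pt f x.
Proof.
  intros H; apply continuity_pt_filterlim.
  apply (ex_derive_continuous f); now exists l.
Qed.

Lemma nondecreasing_of_derive (f f' : R -> R) (x y : R) :
  x <= y ->
  (forall z, x <= z <= y -> is_derive f z (f' z)) ->
  (forall z, x <= z <= y -> 0 <= f' z) ->
  f x <= f y.
Proof.
  intros Hxy Hd Hpos.
  destruct (MVT_gen f x y f') as [c [Hc Heq]];
    rewrite ?(Rmin_left x y Hxy), ?(Rmax_right x y Hxy) in *.
  - intros z Hz; apply Hd; lra.
  - intros z Hz; exact (is_derive_continuity_pt _ _ _ (Hd z Hz)).
  - assert (0 <= f' c * (y - x)) by (apply Rmult_le_pos; [now apply Hpos | lra]).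
    lra.
Qed.

Lemma mean_value_open (f f' : R -> R) (x y : R) :
  x < y ->
  (forall z, x < z < y -> is_derive f z (f' z)) ->
  (forall z, x <= z <= y -> continuity_pt f z) ->
  exists c, x < c < y /\ f y - f x = f' c * (y - x).
Proof.
  intros Hxy Hd Hc.
  pose (pr1 := fun z Hz => exist (fun l => derivable_pt_lim f z l) (f' z)
                             (proj1 (is_derive_Reals _ _ _) (Hd z Hz))).
  destruct (MVT f id x y pr1 (fun z _ => derivable_pt_id z) Hxy Hc)
    as [c [P Heq]].
  - intros z _; apply derivable_continuous_pt, derivable_pt_id.
  - exists c; split; [exact P|].
    rewrite derive_pt_id in Heq; unfold id in Heq; simpl in Heq; lra.
Qed.

(** A function cannot decrease throughout a right neighbourhood of a point where
    it is minimal: the mean value theorem produces the point [a]. *)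
Lemma small_value_rising (f f' : R -> R) (u p eps : R) :
  u < p -> 0 < eps ->
  (forall x, u < x < p -> is_derive f x (f' x)) ->
  continuity_pt f u ->
  (forall x, u < x < p -> f u <= f x) ->
  exists a, u < a < p /\ f a < f u + eps /\ 0 <= f' a.
Proof.
  intros Hup Heps Hd Hc Hmin.
  destruct (proj1 (continuity_pt_locally f u) Hc (mkposreal eps Heps))
    as [[d Hd0] Hnear]; simpl in Hnear.
  pose (v := u + Rmin d (p - u) / 2).
  assert (Hv : u < v < p /\ v - u < d).
  { unfold v; pose proof (Rmin_l d (p - u)); pose proof (Rmin_r d (p - u)).
    assert (0 < Rmin d (p - u)) by (apply Rmin_glb_lt; lra).
    lra. }
  destruct (mean_value_open f f' u v) as [a [Ha Heq]].
  - lra.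
  - intros z Hz; apply Hd; lra.
  - intros z Hz; destruct (Req_dec z u) as [->|Hne]; [exact Hc|].
    apply (is_derive_continuity_pt _ _ (f' z)), Hd; lra.
  - exists a; split; [lra|]; split.
    + assert (Hball : Rabs (f a - f u) < eps).
      { apply Hnear; change (Rabs (a - u) < d).
        rewrite Rabs_pos_eq; lra. }
      apply Rabs_def2 in Hball; lra.
    + assert (Hfv : f u <= f v) by (apply Hmin; lra).
      apply Rnot_lt_le; intros Hneg.
      assert (f' a * (v - u) < 0) by (apply Rmult_neg_pos; lra).
      lra.
Qed.

(** The mirror image of [small_value_rising] under [x -> - x]. *)
Lemma small_value_falling (f f' : R -> R) (p v eps : R) :
  p < v -> 0 < eps ->
  (forall x, p < x < v -> is_derive f x (f' x)) ->
  continuity_pt f v ->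
  (forall x, p < x < v -> f v <= f x) ->
  exists b, p < b < v /\ f b < f v + eps /\ f' b <= 0.
Proof.
  intros Hpv Heps Hd Hc Hmin.
  destruct (small_value_rising (fun x => f (- x)) (fun x => - f' (- x))
              (- v) (- p) eps) as [a [Ha [Hsmall Hslope]]].
  - lra.
  - exact Heps.
  - intros x Hx.
    replace (- f' (- x)) with (scal (-1) (f' (- x)))
      by (unfold scal; simpl; unfold mult; simpl; ring).
    apply (is_derive_comp f Ropp); [apply Hd; lra|].
    auto_derive; [trivial | ring].
  - apply (continuity_pt_comp Ropp f).
    + apply continuity_pt_opp, derivable_continuous_pt, derivable_pt_id.
    + now rewrite Ropp_involutive.
  - intros x Hx; rewrite Ropp_involutive; apply Hmin; lra.
  - rewrite Ropp_involutive in Hsmall.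
    exists (- a); repeat split; lra.
Qed.

(** * The two monotone quantities *)

(** Eliminating [a''] by the equation leaves three nonnegative terms: the square
    [(r a' - k a)^2 / r], the term [lambda r a^2], and
    [(M - a^2 / (1 + a^2)^2) r a^2]. *)
Lemma virial_derivative_nonneg (r k m a a' a'' lambda M : R) :
  0 < r -> k ^ 2 = m ^ 2 -> 0 <= lambda -> a ^ 2 <= M ->
  a'' + 1 / r * a' - m ^ 2 / r ^ 2 * a - lambda * a
    + a ^ 3 / (1 + a ^ 2) ^ 2 = 0 ->
  0 <= a * a' + r * a' ^ 2 + r * a * a'' - 2 * k * (a * a') + M * (r * a ^ 2).
Proof.
  intros Hr Hk Hl HM Heq.
  assert (Ha2 : 0 <= a ^ 2) by apply pow2_ge_0.
  assert (Hden : 1 <= (1 + a ^ 2) ^ 2) by nra.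
  set (q := a ^ 2 / (1 + a ^ 2) ^ 2).
  assert (Hq : q <= M).
  { apply Rle_trans with (a ^ 2); [|exact HM].
    unfold q; apply Rmult_le_reg_r with ((1 + a ^ 2) ^ 2); [lra|].
    unfold Rdiv; rewrite Rmult_assoc, Rinv_l by lra; nra. }
  replace (a * a' + r * a' ^ 2 + r * a * a'' - 2 * k * (a * a')
             + M * (r * a ^ 2))
    with ((r * a' - k * a) ^ 2 / r + lambda * (r * a ^ 2)
            + (M - q) * (r * a ^ 2)).
  - assert (Hra : 0 <= r * a ^ 2) by nra.
    assert (0 <= (r * a' - k * a) ^ 2 / r)
      by (apply Rdiv_le_0_compat; [apply pow2_ge_0 | exact Hr]).
    assert (0 <= lambda * (r * a ^ 2)) by now apply Rmult_le_pos.
    assert (0 <= (M - q) * (r * a ^ 2)) by (apply Rmult_le_pos; lra).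
    lra.
  - replace a'' with (- (1 / r * a') + m ^ 2 / r ^ 2 * a + lambda * a
                        - a ^ 3 / (1 + a ^ 2) ^ 2) by lra.
    rewrite <- Hk; unfold q; field; split; lra.
Qed.

(** Only [k ^ 2] is prescribed: [k = |m|] serves to the left of the maximum of
    [A ^ 2], and [k = - |m|] to its right. *)
Lemma virial_nondecreasing (Rad : R) (m : Z) (A : R -> R) (lambda k M : R)
    (n : R -> R) (x y : R) :
  solution_pair Rad m A lambda -> 0 <= lambda -> k ^ 2 = IZR m ^ 2 ->
  (forall r, 0 <= r <= Rad -> A r ^ 2 <= M) ->
  (forall r, 0 < r < Rad -> is_derive n r (r * A r ^ 2)) ->
  0 < x -> x <= y -> y < Rad ->
  x * A x * Derive A x - k * A x ^ 2 + M * n x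
    <= y * A y * Derive A y - k * A y ^ 2 + M * n y.
Proof.
  intros Hsol Hl Hk HM Hn Hx Hxy Hy.
  apply (nondecreasing_of_derive
    (fun r => r * A r * Derive A r - k * A r ^ 2 + M * n r)
    (fun r => A r * Derive A r + r * Derive A r ^ 2
                + r * A r * Derive (Derive A) r
                - 2 * k * (A r * Derive A r) + M * (r * A r ^ 2))); [exact Hxy| |].
  - intros r Hr.
    assert (Hr' : 0 < r < Rad) by lra.
    pose proof (sol_derivable _ _ _ _ Hsol r Hr') as HA.
    pose proof (sol_derivable2 _ _ _ _ Hsol r Hr') as HA'.
    pose proof (Hn r Hr') as Hnr.
    auto_derive.
    + repeat split; try assumption. now exists (r * A r ^ 2).
    + replace (Derive (fun x0 : R => n x0) r) with (r * A r ^ 2)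
        by (symmetry; exact (is_derive_unique _ _ _ Hnr)).
      change (Derive (fun x0 : R => A x0) r) with (Derive A r).
      change (Derive (fun x0 : R => Derive A x0) r) with (Derive (Derive A) r).
      ring.
  - intros r Hr.
    apply virial_derivative_nonneg with (m := IZR m) (lambda := lambda);
      try assumption; try lra.
    + apply HM; lra.
    + apply (sol_equation _ _ _ _ Hsol); lra.
Qed.

(** * The contradiction for a nonnegative shift *)

(** Clamping makes the integrand continuous on the whole line, so that the
    derivative formula holds at every [r], the endpoints included. *)
Definition mass (Rad : R) (A : R -> R) (r : R) : R :=
  RInt (fun s => s * A (clamp 0 Rad s) ^ 2) 0 r.

Lemma is_derive_mass (Rad : R) (A : R -> R) (r : R) :
  0 <= Rad -> continuous_on (fun r => 0 <= r <= Rad) A ->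
  is_derive (mass Rad A) r (r * A (clamp 0 Rad r) ^ 2).
Proof.
  intros HR HA.
  assert (Hc : forall s, continuous (fun s => s * A (clamp 0 Rad s) ^ 2) s).
  { intros s; apply continuity_pt_filterlim.
    pose proof (continuous_clamp A 0 Rad HR HA s) as Hs.
    apply continuity_pt_filterlim in Hs.
    apply continuity_pt_mult.
    - apply derivable_continuous_pt, derivable_pt_id.
    - apply (continuity_pt_comp (fun s => A (clamp 0 Rad s)) (fun z => z ^ 2));
        [exact Hs|].
      apply derivable_continuous_pt, derivable_pt_pow. }
  apply (is_derive_RInt (fun s => s * A (clamp 0 Rad s) ^ 2)
           (mass Rad A) 0 r); [|apply Hc].
  apply filter_forall; intros x; unfold mass.
  apply (RInt_correct (fun s => s * A (clamp 0 Rad s) ^ 2) 0 x).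
  apply ex_RInt_continuous; intros s _; apply Hc.
Qed.

Lemma photon_number_mass (Rad : R) (A : R -> R) :
  0 <= Rad -> photon_number Rad A = 2 * PI * mass Rad A Rad.
Proof.
  intros HR; unfold photon_number, mass; f_equal.
  apply RInt_ext; intros x Hx.
  rewrite Rmin_left, Rmax_right in Hx by exact HR.
  now rewrite clamp_id by lra.
Qed.

Lemma mass_nondecreasing (Rad : R) (A : R -> R) (x y : R) :
  0 <= Rad -> continuous_on (fun r => 0 <= r <= Rad) A ->
  0 <= x -> x <= y -> mass Rad A x <= mass Rad A y.
Proof.
  intros HR HA Hx Hxy.
  apply (nondecreasing_of_derive _ (fun r => r * A (clamp 0 Rad r) ^ 2));
    [exact Hxy| |].
  - intros r _; now apply is_derive_mass.
  - intros r Hr; apply Rmult_le_pos; [lra | apply pow2_ge_0].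
Qed.

Theorem theorem4p2 (Rad : R) (m : Z) (N0 : R) (A : R -> R) (lambda : R)
  (hRad : 0 < Rad) (hN0 : 0 < N0)
  (hsol : solution_pair Rad m A lambda)
  (hnontriv : nontrivial Rad A)
  (hN : photon_number Rad A = N0)
  (hm : Rabs (IZR m) >= N0 / (2 * PI)) :
  lambda < 0.
Proof.
  apply Rnot_le_lt; intros Hl.
  set (k := Rabs (IZR m)) in *.
  assert (HR : 0 <= Rad) by lra.
  pose proof PI_RGT_0 as Hpi.
  pose proof (sol_continuous _ _ _ _ hsol) as HA.
  assert (Hk2 : k ^ 2 = IZR m ^ 2) by apply pow2_abs.
  assert (Hmass : mass Rad A Rad = N0 / (2 * PI)).
  { rewrite photon_number_mass in hN by exact HR.
    rewrite <- hN; field; lra. }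
  assert (Hk : 0 < k).
  { assert (0 < N0 / (2 * PI)) by (apply Rdiv_lt_0_compat; lra). lra. }
  set (f := fun r => A (clamp 0 Rad r) ^ 2).
  assert (HfA : forall r, 0 <= r <= Rad -> f r = A r ^ 2)
    by (intros r Hr; unfold f; now rewrite clamp_id).
  assert (Hf0 : f 0 = 0)
    by (rewrite HfA, (sol_boundary_0 _ _ _ _ hsol) by lra; ring).
  assert (HfR : f Rad = 0)
    by (rewrite HfA, (sol_boundary_R _ _ _ _ hsol) by lra; ring).
  assert (Hfc : forall r, continuity_pt f r).
  { intros r.
    apply (continuity_pt_comp (fun r => A (clamp 0 Rad r)) (fun z => z ^ 2)).
    - apply continuity_pt_filterlim, (continuous_clamp A 0 Rad HR HA r).
    - apply derivable_continuous_pt, derivable_pt_pow. }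
  assert (Hfd : forall r, 0 < r < Rad -> is_derive f r (2 * (A r * Derive A r))).
  { intros r Hr.
    apply (is_derive_clamp (fun r => A r ^ 2)); [exact Hr|].
    pose proof (sol_derivable _ _ _ _ hsol r Hr) as Hd.
    auto_derive; [exact Hd|].
    change (Derive (fun x : R => A x) r) with (Derive A r); ring. }
  destruct (continuity_ab_maj f 0 Rad HR) as [p [Hmax Hp]];
    [intros; apply Hfc|].
  set (M := f p) in *.
  assert (HM : 0 < M).
  { destruct hnontriv as [r [Hr Hne]].
    apply Rlt_le_trans with (f r); [|now apply Hmax].
    rewrite HfA by exact Hr; now apply pow2_gt_0. }
  assert (Hpint : 0 < p < Rad).
  { split; apply Rnot_le_lt; intros Hle.
    - assert (p = 0) by lra; subst p; unfold M in HM; lra.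
    - assert (p = Rad) by lra; subst p; unfold M in HM; lra. }
  destruct (small_value_rising f (fun r => 2 * (A r * Derive A r)) 0 p (M / 2))
    as [a [Ha [HaM Hda]]]; try lra; try apply Hfc.
  { intros r Hr; apply Hfd; lra. }
  { intros r Hr; rewrite Hf0; apply pow2_ge_0. }
  destruct (small_value_falling f (fun r => 2 * (A r * Derive A r)) p Rad (M / 2))
    as [b [Hb [HbM Hdb]]]; try lra; try apply Hfc.
  { intros r Hr; apply Hfd; lra. }
  { intros r Hr; rewrite HfR; apply pow2_ge_0. }
  assert (HAM : forall r, 0 <= r <= Rad -> A r ^ 2 <= M)
    by (intros r Hr; rewrite <- HfA by exact Hr; now apply Hmax).
  assert (Hn : forall r, 0 < r < Rad -> is_derive (mass Rad A) r (r * A r ^ 2)).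
  { intros r Hr; rewrite <- (HfA r) by lra.
    now apply is_derive_mass. }
  assert (Hap := virial_nondecreasing Rad m A lambda k M (mass Rad A) a p
                   hsol Hl Hk2 HAM Hn ltac:(lra) ltac:(lra) ltac:(lra)).
  assert (Hpb := virial_nondecreasing Rad m A lambda (- k) M (mass Rad A) p b
                   hsol Hl ltac:(rewrite <- Hk2; ring) HAM Hn
                   ltac:(lra) ltac:(lra) ltac:(lra)).
  rewrite <- (HfA a), <- (HfA p) in Hap by lra; fold M in Hap.
  rewrite <- (HfA p), <- (HfA b) in Hpb by lra; fold M in Hpb.
  assert (Hn0 : 0 <= mass Rad A a).
  { replace 0 with (mass Rad A 0) by exact (RInt_point 0 _).
    apply mass_nondecreasing; lra || assumption. }
  assert (HnR : mass Rad A b <= k).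
  { apply Rle_trans with (mass Rad A Rad); [|lra].
    apply mass_nondecreasing; lra || assumption. }
  (* The terms at [p] with [A'(p)] cancel between [Hap] and [Hpb]. *)
  assert (0 <= a * A a * Derive A a) by nra.
  assert (b * A b * Derive A b <= 0) by nra.
  assert (M * mass Rad A b <= M * k) by (apply Rmult_le_compat_l; lra).
  assert (0 <= M * mass Rad A a) by (apply Rmult_le_pos; lra).
  assert (k * (f a + f b) < k * M) by (apply Rmult_lt_compat_l; lra).
  lra.
Qed.
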